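(* Let $X$ be a complex topological vector space and let $\Gamma\subset\mathcal{B}(X)$. If $\Gamma$ is strictly disk transitive, then it is disk transitive. As a consequence, if $\Gamma$ is strictly disk transitive, then it is diskcyclic.
   Context: $\mathcal{B}(X)$ is the set of all continuous linear operators on $X$, and $\mathbb{D}=\{\alpha\in\mathbb{C}:|\alpha|\le 1\}$. $\Gamma$ is strictly disk transitive if for each pair of nonzero elements $x,y\in X$ there exist $\alpha\in\mathbb{D}$ and $T\in\Gamma$ such that $\alpha Tx=y$. $\Gamma$ is disk transitive if for any pair $(U,V)$ of nonempty open subsets of $X$ there exist $\alpha\in\mathbb{D}\setminus\{0\}$ and $T\in\Gamma$ such that $T(\alpha U)\cap V\neq\emptyset$. $\Gamma$ is diskcyclic if there is $x\in X$ such that $\{\alpha Tx:\alpha\in\mathbb{D},\,T\in\Gamma\}$ is dense in $X$.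
   Formalization: Γ is assumed nonempty; this excludes only X = {0} with Γ empty, where Γ is vacuously strictly disk transitive but neither disk transitive nor diskcyclic. *)

(* Defs.v *)
From HB Require Import structures.
From mathcomp Require Import all_boot all_order all_algebra.
From mathcomp Require Import all_classical all_reals all_analysis.
From mathcomp Require Export complex.
Set Implicit Arguments.
Unset Strict Implicit.
Unset Printing Implicit Defensive.
Import Order.TTheory GRing.Theory Num.Theory.
Local Open Scope classical_set_scope.
Local Open Scope ring_scope.
Local Open Scope complex_scope.

(* [topologicalLmodType] rather than [tvsType], since the latter also requires
   local convexity. *)
Definition continuous_operators (R : realType) (X : topologicalLmodType R[i]) :
    set {linear X -> X} :=
  [set T | continuous T].

(* The order of R[i] compares real parts and requires equal imaginary parts, so
   this is the closed unit disk. *)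
Definition closed_unit_disk (R : realType) : set R[i] :=
  [set a | `|a| <= 1].

Definition strictly_disk_transitive (R : realType)
    (X : topologicalLmodType R[i]) (Gamma : set {linear X -> X}) : Prop :=
  forall x y : X, x != 0 -> y != 0 ->
    exists a (T : {linear X -> X}),
      [/\ @closed_unit_disk R a, Gamma T & a *: T x = y].

Definition disk_transitive (R : realType)
    (X : topologicalLmodType R[i]) (Gamma : set {linear X -> X}) : Prop :=
  forall U V : set X, open U -> U !=set0 -> open V -> V !=set0 ->
    exists a (T : {linear X -> X}),
      [/\ (@closed_unit_disk R `\ 0) a, Gamma T &
          (T @` [set a *: u | u in U]) `&` V !=set0].

Definition disk_orbit (R : realType) (X : topologicalLmodType R[i])
    (Gamma : set {linear X -> X}) (x : X) : set X :=
  [set a *: (T : {linear X -> X}) x | a in @closed_unit_disk R & T in Gamma].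

Definition diskcyclic (R : realType)
    (X : topologicalLmodType R[i]) (Gamma : set {linear X -> X}) : Prop :=
  exists x : X, dense (disk_orbit Gamma x).

(* Main.v *)
Require Import Defs.
From HB Require Import structures.
From mathcomp Require Import all_boot all_order all_algebra.
From mathcomp Require Import all_classical all_reals all_analysis.
Set Implicit Arguments.
Unset Strict Implicit.
Unset Printing Implicit Defensive.
Import Order.TTheory GRing.Theory Num.Theory.
Local Open Scope classical_set_scope.
Local Open Scope ring_scope.
Local Open Scope complex_scope.

(** Strict transitivity only concerns nonzero vectors, so the point is to find such vectors in open
    sets: [open_neq0] does this as soon as the space is not zero. For nonzero [u] in [U] and [v] in
    [V], a solution of [a *: T u = v] gives [T (a *: u) = v] by linearity. Likewise the disk orbit
    of any nonzero vector contains all nonzero vectors, hence meets every nonempty open set. *)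

Lemma open_neq0 (K : numFieldType) (X : topologicalLmodType K) (x : X)
    (U : set X) :
  x != 0 -> open U -> U !=set0 -> exists2 u, U u & u != 0.
Proof.
move=> x0 oU [u Uu]; have [u0|] := eqVneq u 0; last by exists u.
(* Small nonzero multiples of [x] tend to [0], hence enter [U]. *)
have U0x : nbhs ((0 : K^o) *: x) U by rewrite scale0r -u0; exact: open_nbhs_nbhs.
have [[A B] /= [/nbhs_ballP[e /= e0 eA] Bx] ABU] :=
  scale_continuous ((0 : K^o), x) U U0x.
(* Halving puts a nonzero scalar strictly inside the open ball of radius [e] around 0. *)
have e20 : 0 < e / 2 by rewrite divr_gt0.
exists ((e / 2) *: x); last by rewrite scaler_eq0 negb_or gt_eqF.
apply: (ABU (e / 2, x)); split => /=; last exact: nbhs_singleton.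
apply: eA; rewrite /ball /= sub0r normrN gtr0_norm //.
by rewrite ltr_pdivrMr // ltr_pMr // ltr1n.
Qed.

Theorem proposition3p10 (R : realType) (X : topologicalLmodType R[i])
    (Gamma : set {linear X -> X}) :
  Gamma `<=` @continuous_operators R X ->
  Gamma !=set0 ->
  (strictly_disk_transitive Gamma -> disk_transitive Gamma) /\
  (strictly_disk_transitive Gamma -> diskcyclic Gamma).
Proof.
move=> _ [T0 GT0].
have disk1 : @closed_unit_disk R 1 by rewrite /closed_unit_disk /= normr1.
(* On the zero space strict transitivity is vacuous; the operator [T0] with scalar 1 serves as
   witness instead. *)
have [[x x0]|X0] := pselect (exists x : X, x != 0); last first.
  have {}X0 (u : X) : u = 0.
    by apply: contrapT => /eqP u0; apply: X0; exists u.
  split=> _.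
    move=> U V _ [u Uu] _ [v Vv]; exists 1, T0; split=> //.
      by split=> //=; exact/eqP/oner_neq0.
    exists v; split=> //; exists u; last by rewrite [LHS]X0 [RHS]X0.
    by exists u => //; rewrite scale1r.
  exists 0 => O [u Ou] _; exists u; split=> //.
  by exists 1 => //; exists T0 => //; rewrite [LHS]X0 [RHS]X0.
split=> trG.
  move=> U V oU U0 oV V0.
  have [u Uu u0] := open_neq0 x0 oU U0.
  have [v Vv v0] := open_neq0 x0 oV V0.
  have [a [T [da GT aTu]]] := trG u v u0 v0.
  exists a, T; split=> //.
    (* The scalar is nonzero because [v] is. *)
    by split=> //= a0; move: v0; rewrite -aTu a0 scale0r eqxx.
  exists v; split=> //; exists (a *: u); last by rewrite linearZ.
  by exists u.
exists x => O O0 oO; have [y Oy y0] := open_neq0 x0 oO O0.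
have [a [T [da GT aTx]]] := trG x y x0 y0.
by exists y; split=> //; exists a => //; exists T.
Qed.
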